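(* Let $n$ be a positive integer, $k\in\{1,\dots,n\}\setminus\{1\}$, and let $A,B\colon[0,1]^n\to[0,1]$ be $n$-variate semicopulas with $A\le B$. Let $\mathcal D\subseteq[0,1]^n$ be a dense countably infinite mesh and $C\colon\mathcal D\to[0,1]$ a $k$-increasing function such that $A(\mathbf d)\le C(\mathbf d)\le B(\mathbf d)$ for all $\mathbf d\in\mathcal D$. Then $C$ can be extended to a $k$-increasing function $C'\colon[0,1]^n\to[0,1]$ such that $A(\mathbf x)\le C'(\mathbf x)\le B(\mathbf x)$ for all $\mathbf x\in[0,1]^n$.
   Context: Write $\mathbb I=[0,1]$; $\le$ between functions is the pointwise order, and ''increasing'' means non-decreasing. Mesh. A dense countably infinite mesh in $\mathbb I^n$ is a set $\mathcal D=\prod_{i=1}^n\delta_i$ where each $\delta_i\subseteq\mathbb I$ is countably infinite, dense in $\mathbb I$, and contains both $0$ and $1$. Boxes. For $\mathbf x,\mathbf y\in\mathbb I^n$, the product $R=[\mathbf x,\mathbf y]=\prod_{i=1}^n[x_i,y_i]$ is a $k$-box if $x_i<y_i$ for exactly $k$ indices $i$ and $x_i=y_i$ for the remaining $n-k$ indices. Its vertices are $\operatorname{ver}R=\prod_{i=1}^n\{x_i,y_i\}$. The sign of a vertex $\mathbf v$ is $\operatorname{sign}_R(\mathbf v)=(-1)^{m-(n-k)}$, where $m=|\{i: v_i=x_i\}|$. Functions. A function $f$ on $\mathbb I^n$ (resp. on $\mathcal D$) with values in $\mathbb I$ is $k$-increasing if $\sum_{\mathbf v\in\operatorname{ver}R}\operatorname{sign}_R(\mathbf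 v)f(\mathbf v)\ge0$ for every $k$-box $R$ with vertices in $\mathbb I^n$ (resp. in $\mathcal D$); $1$-increasing means increasing in each variable. $f\colon\mathbb I^n\to\mathbb I$ is grounded if $f(\mathbf x)=0$ whenever some $x_i=0$; it has uniform marginals if $f(1,\dots,1,x_i,1,\dots,1)=x_i$ for all $x_i\in\mathbb I$ and all $i$. A semicopula is a grounded, $1$-increasing function $\mathbb I^n\to\mathbb I$ with uniform marginals. *)

(* Defs.v *)
From mathcomp Require Import all_boot all_order all_algebra.
From mathcomp Require Import all_classical all_reals all_analysis.

Set Implicit Arguments.
Unset Strict Implicit.
Unset Printing Implicit Defensive.

Import Order.TTheory GRing.Theory Num.Theory.
Import numFieldNormedType.Exports.

Local Open Scope classical_set_scope.
Local Open Scope ring_scope.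

(* Points of R^n are row vectors.  A function on a set S of points is a total
   function 'rV[R]_n -> R of which only the values on S are ever used; that its
   values on S lie in a set J is expressed by [set_fun S J f]. *)

Definition unit_itv (R : realType) : set R := `[0, 1]%classic.
Arguments unit_itv : clear implicits.

Definition unit_cube (R : realType) (n : nat) : set 'rV[R]_n :=
  [set x | forall i, unit_itv R (x 0 i)].
Arguments unit_cube : clear implicits.

(* For d contained in [0,1], being dense in [0,1] is [0,1] `<=` closure d; the
   library's [dense] is density in the whole space and does not apply. *)
Definition dense_countable_mesh (R : realType) (n : nat) (D : set 'rV[R]_n) :
    Prop :=
  exists delta : 'I_n -> set R,
    (forall i, [/\ delta i `<=` unit_itv R,
                   countable (delta i) /\ infinite_set (delta i),
                   unit_itv R `<=` closure (delta i)
                 & delta i 0 /\ delta i 1])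
    /\ D = [set x | forall i, delta i (x 0 i)].

(* [x, y] is a k-box. *)
Definition is_box (R : realType) (n k : nat) (x y : 'rV[R]_n) : Prop :=
  (forall i, x 0 i <= y 0 i) /\ #|[pred i | x 0 i < y 0 i]| = k.

Definition ver (R : realType) (n : nat) (x y : 'rV[R]_n) : set 'rV[R]_n :=
  [set v | forall i, v 0 i = x 0 i \/ v 0 i = y 0 i].

(* Sign of the vertex v of a k-box [x, y].  The n - k indices with
   x 0 i = y 0 i all satisfy v 0 i = x 0 i, so neither subtraction truncates. *)
Definition vertex_sign (R : realType) (n k : nat) (x v : 'rV[R]_n) : R :=
  (-1) ^+ (#|[pred i | v 0 i == x 0 i]| - (n - k)).

(* The sum ranges over ver x y as a set of points (finite), so vertices that
   coincide in a degenerate box are counted once. *)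
Definition k_increasing (R : realType) (n k : nat) (S : set 'rV[R]_n)
    (f : 'rV[R]_n -> R) : Prop :=
  forall x y, is_box k x y -> ver x y `<=` S ->
    0 <= \sum_(v \in ver x y) vertex_sign k x v * f v.

Definition grounded (R : realType) (n : nat) (f : 'rV[R]_n -> R) : Prop :=
  forall x, unit_cube R n x -> (exists i, x 0 i = 0) -> f x = 0.

Definition uniform_marginals (R : realType) (n : nat) (f : 'rV[R]_n -> R) :
    Prop :=
  forall (i : 'I_n) (t : R), unit_itv R t ->
    f (\row_j (if j == i then t else 1)) = t.

Definition semicopula (R : realType) (n : nat) (f : 'rV[R]_n -> R) : Prop :=
  [/\ set_fun (unit_cube R n) (unit_itv R) f,
      grounded f,
      k_increasing 1 (unit_cube R n) f
    & uniform_marginals f].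

(* Main.v *)
(** For [k >= 2] a [k]-increasing grounded function is 2- and 1-increasing:
    stretching a box down to 0 in one of its degenerate directions does not
    change its volume, as the function vanishes at the new vertices.  Being squeezed between semicopulas, [C]
    is grounded with uniform marginals, hence increasing and 1-Lipschitz in each
    variable, that is, [C x - C y <= \sum_i max(0, x_i - y_i)].  The extension
    is McShane's, [C' x = sup_d (C d - \sum_i max(0, d_i - x_i))].  The bounds
    follow from approximating [x] by mesh points above it (for [A]) and below
    it (for [B]), so that no continuity of [A] and [B] is needed, and volumes of
    boxes are limits of volumes of mesh boxes with the same degenerate sides. *)
Require Import Defs.
From mathcomp Require Import all_boot all_order all_algebra.
From mathcomp Require Import all_classical all_reals all_analysis.
From mathcomp Require Import lra.

Set Implicit Arguments.
Unset Strict Implicit.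
Unset Printing Implicit Defensive.

Import Order.TTheory GRing.Theory Num.Theory.
Import numFieldNormedType.Exports.

Local Open Scope classical_set_scope.
Local Open Scope ring_scope.

(** * Box volumes as alternating sums over subsets of the nondegenerate directions *)

Section Boxes.
Variables (R : realType) (n : nat).
Implicit Types (x y : 'rV[R]_n) (J : {set 'I_n}) (f : 'rV[R]_n -> R).

Definition mix x y (s : {set 'I_n}) : 'rV[R]_n :=
  \row_i (if i \in s then y 0 i else x 0 i).

Definition upd x i (t : R) : 'rV[R]_n := \row_j (if j == i then t else x 0 j).

Definition mesh (delta : 'I_n -> set R) : set 'rV[R]_n :=
  [set x | forall i, delta i (x 0 i)].

(** A vertex is encoded by the subset [s] of [J] where it takes the coordinate of [y], and the
    exponent counts the directions of [J] where it takes that of [x]. Only the coordinates of [y] in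
    [J] matter, so [x] may be moved in other directions without adjusting [y]. *)
Definition box_volume f x y J : R :=
  \sum_(s in powerset J) (-1) ^+ (#|J| - #|s|) * f (mix x y s).

Lemma mesh_mix delta x y s :
  mesh delta x -> mesh delta y -> mesh delta (mix x y s).
Proof. by move=> Dx Dy i; rewrite mxE; case: ifP => _; [exact: Dy|exact: Dx]. Qed.

Lemma mesh_upd delta x i t :
  mesh delta x -> delta i t -> mesh delta (upd x i t).
Proof. by move=> Dx Dt j; rewrite mxE; case: eqP => [->|_]. Qed.

Lemma upd_id x i : upd x i (x 0 i) = x.
Proof. by apply/rowP => j; rewrite mxE; case: eqP => [->|]. Qed.

Lemma upd_upd x i (s t : R) : upd (upd x i s) i t = upd x i t.
Proof. by apply/rowP => j; rewrite !mxE; case: eqP. Qed.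

Lemma mesh_ver delta x y :
  mesh delta x -> mesh delta y -> ver x y `<=` mesh delta.
Proof. by move=> Dx Dy v xyv i; case: (xyv i) => ->. Qed.

(** [mix x y] is a bijection from the subsets of [J] onto the vertices: injective since [x] and [y]
    differ on [J], surjective since they agree off [J]. *)
Lemma sum_ver f x y J :
    (forall i, i \in J -> x 0 i < y 0 i) ->
    (forall i, i \notin J -> x 0 i = y 0 i) ->
  \sum_(v \in ver x y) vertex_sign #|J| x v * f v = box_volume f x y J.
Proof.
move=> xyJ xyE; rewrite /box_volume -big_enum [RHS]fsbig_seq ?enum_uniq//=.
rewrite (reindex_fsbig (mix x y) [set` enum (powerset J)]); last first.
  split.
  - move=> s _ i; rewrite mxE; case: ifP => _; [by right|by left].
  - move=> s t; rewrite !inE/= !mem_enum !powersetE => sJ tJ /rowP st.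
    apply/setP => i; have := st i; rewrite !mxE.
    have [iJ|iJ] := boolP (i \in J); last first.
      by rewrite (contraNF (fintype.subsetP sJ i) iJ)
                 (contraNF (fintype.subsetP tJ i) iJ).
    by case: ifP => _; case: ifP => _ // E; move: (xyJ _ iJ); rewrite E ltxx.
  - move=> v xyv; exists [set i in J | v 0 i == y 0 i]%SET.
      rewrite /= mem_enum powersetE; apply/fintype.subsetP => i.
      by rewrite inE => /andP[].
    apply/rowP => i; rewrite mxE inE; have [iJ|iJ] := boolP (i \in J) => /=.
      by case: eqP => // /eqP; case: (xyv i) => [->//|->]; rewrite eqxx.
    by case: (xyv i) => ->//; rewrite xyE.
apply: eq_fsbigr => s; rewrite inE/= mem_enum powersetE => sJ.
congr (_ ^+ _ * _).
(* The vertex agrees with [x] exactly off [s], so the exponent is [(n - #|s|) - (n - #|J|)]; both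
   cardinals are at most [n], hence no truncation. *)
have -> : #|[pred i | mix x y s 0 i == x 0 i]| = #|(~: s)%SET|.
  apply: eq_card => i; rewrite !inE mxE; case: ifP => [si|]; last by rewrite eqxx.
  by rewrite gt_eqF// xyJ// (fintype.subsetP sJ).
rewrite cardsCs finset.setCK card_ord.
have := max_card J; rewrite card_ord => /subnBA->.
have := max_card s; rewrite card_ord => /addnBA sn.
by rewrite addnC sn subnAC addnK.
Qed.

Lemma k_increasing_volume_ge0 delta f x y J :
    k_increasing #|J| (mesh delta) f -> mesh delta x -> mesh delta y ->
    (forall i, i \in J -> x 0 i < y 0 i) ->
    (forall i, i \notin J -> x 0 i = y 0 i) ->
  0 <= box_volume f x y J.
Proof.
move=> kf Dx Dy xyJ xyE; rewrite -sum_ver//; apply: kf; last exact: mesh_ver.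
split.
  by move=> i; have [/xyJ/ltW//|/xyE->] := boolP (i \in J).
apply: eq_card => i; rewrite inE; have [/xyJ//|/xyE->] := boolP (i \in J).
by rewrite ltxx.
Qed.

Lemma box_volume_k_increasing delta k f :
    (forall x y J, #|J| = k -> mesh delta x -> mesh delta y ->
      (forall i, i \in J -> x 0 i < y 0 i) ->
      (forall i, i \notin J -> x 0 i = y 0 i) -> 0 <= box_volume f x y J) ->
  k_increasing k (mesh delta) f.
Proof.
move=> kf x y [xy xyk] verD; pose J := [set i | x 0 i < y 0 i]%SET.
have Jk : #|J| = k by rewrite -xyk; apply: eq_card => i; rewrite !inE.
have xyJ i : i \in J -> x 0 i < y 0 i by rewrite inE.
have xyE i : i \notin J -> x 0 i = y 0 i.
  by rewrite inE -leNgt => yx; apply/eqP; rewrite eq_le xy yx.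
rewrite -Jk sum_ver//; apply: kf => //; apply: verD => i; [by left|by right].
Qed.

Lemma box_volume0 f x y : box_volume f x y finset.set0 = f x.
Proof.
rewrite /box_volume powerset0 big_set1 subnn expr0 mul1r; congr f.
by apply/rowP => i; rewrite mxE inE.
Qed.

(** Splitting the subsets by whether they contain [j] separates the two opposite faces in direction
    [j]; the face at [x] carries one more factor -1. *)
Lemma box_volumeU1 f x y j J : j \notin J ->
  box_volume f x y (j |: J) =
  box_volume f (upd x j (y 0 j)) y J - box_volume f x y J.
Proof.
move=> jJ; rewrite /box_volume (bigID (fun s : {set 'I_n} => j \in s))/= -sumrN.
have mix1 s : mix x y (j |: s) = mix (upd x j (y 0 j)) y s.
  apply/rowP => i; rewrite !mxE !inE.
  by case: eqP => [->|//]; case: ifP.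
congr (_ + _).
  rewrite (reindex_onto (fun s : {set 'I_n} => j |: s)%SET
                        (fun s => s :\ j)%SET)/=; last first.
    by move=> s /andP[_ js]; rewrite finset.setD1K.
  apply: eq_big => [s|s].
    rewrite !powersetE setU11 andbT.
    apply/andP/idP => [[sJ /eqP <-]|sJ].
      by rewrite subDset; apply: fintype.subset_trans sJ _; rewrite fintype.subxx.
    rewrite finset.setUS//; split => //; apply/eqP/setU1K.
    by apply: contra jJ; apply/fintype.subsetP.
  move=> /andP[/andP[_ _] /eqP sE]; have js : j \notin s by rewrite -sE !inE eqxx.
  by rewrite !cardsU1 js jJ mix1 subSS.
apply: eq_big => [s|s].
  rewrite !powersetE; apply/andP/idP => [[sJ js]|sJ].
    apply/fintype.subsetP => i si; have := fintype.subsetP sJ _ si.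
    by rewrite !inE; case: eqP => // ij; move: js; rewrite -ij si.
  split; first by apply: fintype.subset_trans sJ (finset.subsetUr _ _).
  by apply: contra jJ; apply/fintype.subsetP.
rewrite powersetE => /andP[sJ js].
(* Without this bound the truncated exponent would not grow by one when [j] joins [J]. *)
have sJ' : (#|s| <= #|J|)%N.
  apply/subset_leq_card/fintype.subsetP => i si.
  have := fintype.subsetP sJ _ si; rewrite !inE.
  by case: eqP => // ij; move: js; rewrite -ij si.
by rewrite cardsU1 jJ add1n subSn// exprS mulN1r mulNr.
Qed.

End Boxes.

(** * Monotonicity and Lipschitz estimates on a mesh *)

Section Mesh.
Variables (R : realType) (n : nat) (delta : 'I_n -> set R).
Implicit Types (x y : 'rV[R]_n) (f : 'rV[R]_n -> R).

Lemma k_increasing_pred k f : (k < n)%N ->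
    (forall i, delta i 0) -> (forall i t, delta i t -> 0 <= t) ->
    (forall x i, mesh delta x -> x 0 i = 0 -> f x = 0) ->
  k_increasing k.+1 (mesh delta) f -> k_increasing k (mesh delta) f.
Proof.
move=> kn d0 dge0 f0 kf.
apply: box_volume_k_increasing => x y J Jk Dx Dy xyJ xyE.
have [j jJ] : exists j, j \notin J.
  apply/existsP; apply: contraTT kn; rewrite negb_exists => /forallP JT.
  rewrite -leqNgt -Jk -[n in (n <= _)%N]card_ord subset_leq_card//.
  by apply/fintype.subsetP => i _; have := JT i; rewrite negbK.
have Dx0 := mesh_upd Dx (d0 j).
have v0 : box_volume f (upd x j 0) y J = 0.
  rewrite /box_volume big1// => s; rewrite powersetE => sJ.
  rewrite (f0 _ j) ?mulr0//; first exact: mesh_mix.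
  by rewrite !mxE eqxx (contraNF (fintype.subsetP sJ j) jJ).
(* If the box already lies in the face at 0 it cannot be stretched, but then its volume is zero. *)
have [yj0|yj0] := eqVneq (y 0 j) 0.
  by rewrite -(upd_id x j) xyE// yj0 v0.
have := box_volumeU1 f (upd x j 0) y jJ.
rewrite v0 subr0 upd_upd -xyE// upd_id => <-.
apply: (@k_increasing_volume_ge0 _ _ delta) => //.
- by rewrite cardsU1 jJ Jk.
- move=> i; rewrite !inE mxE; case: eqP => [->|_ /xyJ//] _.
  by rewrite lt_neqAle eq_sym yj0 (dge0 j).
- by move=> i; rewrite !inE negb_or mxE => /andP[/negbTE-> /xyE].
Qed.

Lemma k_increasing_le k m f : (k <= m <= n)%N ->
    (forall i, delta i 0) -> (forall i t, delta i t -> 0 <= t) ->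
    (forall x i, mesh delta x -> x 0 i = 0 -> f x = 0) ->
  k_increasing m (mesh delta) f -> k_increasing k (mesh delta) f.
Proof.
move=> /andP[km mn] d0 dge0 f0; rewrite -(subnKC km) in mn *.
elim: (m - k)%N mn => [|p IH]; first by rewrite addn0.
rewrite addnS => mn mf; apply: IH; first exact: ltnW.
exact: k_increasing_pred.
Qed.

Lemma increasing_upd f x i t : k_increasing 1 (mesh delta) f ->
  mesh delta x -> delta i t -> x 0 i <= t -> f x <= f (upd x i t).
Proof.
move=> f1 Dx Dt; rewrite le_eqVlt => /predU1P[<-|xt]; first by rewrite upd_id.
have := box_volumeU1 f x (upd x i t) (negbT (finset.in_set0 i)).
rewrite !box_volume0 finset.setU0 mxE eqxx -subr_ge0 => <-.
apply: (@k_increasing_volume_ge0 _ _ delta) => //; first by rewrite cards1.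
- exact: mesh_upd.
- by move=> j; rewrite inE mxE => /eqP->; rewrite eqxx.
- by move=> j; rewrite inE mxE => /negbTE->.
Qed.

(** The difference of the two sides is the volume of the rectangle spanned in directions [i] and
    [j]. If a side of it degenerates, both increments coincide. *)
Lemma two_increasing_upd f x i j t u :
    k_increasing 2 (mesh delta) f -> i != j ->
    mesh delta x -> delta i t -> delta j u -> x 0 i <= t -> x 0 j <= u ->
  f (upd x i t) - f x <= f (upd (upd x j u) i t) - f (upd x j u).
Proof.
move=> f2 ij Dx Dt Du; rewrite le_eqVlt => /predU1P[<- _|xt].
  have -> : x 0 i = upd x j u 0 i by rewrite mxE (negbTE ij).
  by rewrite upd_id mxE (negbTE ij) upd_id !subrr.
rewrite le_eqVlt => /predU1P[<-|xu]; first by rewrite upd_id.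
pose y := upd (upd x j u) i t.
have yi : y 0 i = t by rewrite mxE eqxx.
have yj : y 0 j = u by rewrite !mxE eq_sym (negbTE ij) eqxx.
have iNj : i \notin [set j]%SET by rewrite inE.
have jN0 : j \notin finset.set0 by rewrite inE.
have := box_volumeU1 f x y iNj; rewrite -(finset.setU0 [set j]%SET).
rewrite !(box_volumeU1 _ _ _ jN0) !box_volume0 yi yj finset.setU0.
have -> : upd (upd x i t) j u = y.
  apply/rowP => l; rewrite !mxE; case: eqP => [->|//].
  by rewrite eq_sym (negbTE ij).
have : 0 <= box_volume f x y (i |: [set j]).
  apply: (@k_increasing_volume_ge0 _ _ delta) => //.
  - by rewrite cards2 ij.
  - by apply: mesh_upd => //; exact: mesh_upd.
  - by move=> l; rewrite !inE => /orP[] /eqP->; rewrite ?yi ?yj.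
  - by move=> l; rewrite !inE !mxE negb_or => /andP[/negbTE-> /negbTE->].
by rewrite /y; lra.
Qed.

(* By 2-increasingness the increment in one variable grows when the other
   variables are raised to 1, where the marginals make it equal to [t - x i]. *)
Lemma lipschitz_upd f x i t :
    k_increasing 2 (mesh delta) f ->
    (forall j, delta j 1) -> (forall j u, delta j u -> u <= 1) ->
    (forall j u, delta j u -> f (upd (const_mx 1) j u) = u) ->
    mesh delta x -> delta i t -> x 0 i <= t ->
  f (upd x i t) - f x <= t - x 0 i.
Proof.
move=> f2 d1 dle1 fm + Dt.
(* Induction on the number of coordinates other than [i] still to be raised to 1. *)
have [m] := ubnP #|[set j | (j != i) && (x 0 j != 1)]%SET|.
elim: m x => // m IH x xm Dx xt.
have [/existsP[j /andP[ji xj]]|] := boolP [exists j, (j != i) && (x 0 j != 1)].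
  have ij : i != j by rewrite eq_sym.
  have -> : x 0 i = upd x j 1 0 i by rewrite mxE (negbTE ij).
  apply: le_trans (two_increasing_upd f2 ij Dx Dt (d1 j) xt (dle1 _ _ (Dx j))) _.
  apply: IH; last 2 first.
  - exact: mesh_upd.
  - by rewrite mxE (negbTE ij).
  rewrite -ltnS; apply: leq_ltn_trans xm; apply: proper_card.
  apply/properP; split.
    apply/fintype.subsetP => l; rewrite !inE mxE; case: ifP => //.
    by rewrite eqxx andbF.
  by exists j; rewrite !inE ?ji ?xj// mxE !eqxx.
rewrite negb_exists => /forallP x1.
have xE u : upd x i u = upd (const_mx 1) i u.
  apply/rowP => j; rewrite !mxE; case: eqP => // /eqP ji.
  by have := x1 j; rewrite ji/= negbK => /eqP.
by rewrite -[in f x](upd_id x i) !xE !fm.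
Qed.

(** Walk from [x] to [y] changing one coordinate at a time: coordinate [i] still equals that of [x]
    when its turn comes. The cost [w] is left free to serve both the Lipschitz bound and the
    monotonicity of semicopulas. *)
Lemma mesh_chain f (w : R -> R -> R) x y :
    (forall z i t, mesh delta z -> delta i t ->
      f (upd z i t) - f z <= w (z 0 i) t) ->
    mesh delta x -> mesh delta y ->
  f y - f x <= \sum_i w (x 0 i) (y 0 i).
Proof.
move=> fw Dx Dy.
(* The set of changed coordinates becomes a duplicate-free list, on which the induction runs. *)
have -> : y = mix x y [set i in enum 'I_n]%SET.
  by apply/rowP => i; rewrite mxE inE mem_enum.
have -> : \sum_i w (x 0 i) (mix x y [set i in enum 'I_n]%SET 0 i) =
    \sum_(i <- enum 'I_n) w (x 0 i) (y 0 i).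
  by rewrite big_enum; apply: eq_bigr => i _; rewrite mxE inE mem_enum.
elim: (enum 'I_n) (enum_uniq 'I_n) => [_|i r IH /= /andP[ir ur]].
  rewrite big_nil (_ : mix _ _ _ = x) ?subrr//.
  by apply/rowP => i; rewrite mxE inE.
have -> : mix x y [set j in i :: r]%SET =
    upd (mix x y [set j in r]%SET) i (y 0 i).
  by apply/rowP => j; rewrite !mxE !inE; case: eqP => [->|].
have xi : mix x y [set j in r]%SET 0 i = x 0 i by rewrite mxE inE (negbTE ir).
have := fw _ i _ (mesh_mix [set j in r]%SET Dx Dy) (Dy i).
by rewrite big_cons xi; have := IH ur; lra.
Qed.

End Mesh.

(** * McShane extension for a one-sided distance *)

Section Extension.
Variables (R : realType) (n : nat).
Implicit Types (x y z d : 'rV[R]_n) (f : 'rV[R]_n -> R) (D : set 'rV[R]_n).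

(** A one-sided l^1 distance, zero when [x] is below [y]: bounding [f x - f y] by it expresses at
    once that [f] is increasing and 1-Lipschitz in each variable. *)
Definition excess x y : R := \sum_i Num.max 0 (x 0 i - y 0 i).

Lemma excessxx x : excess x x = 0.
Proof. by apply: big1 => i _; rewrite subrr maxxx. Qed.

Lemma excess_triangle y x z : excess x z <= excess x y + excess y z.
Proof.
rewrite /excess -big_split/=; apply: ler_sum => i _.
rewrite ge_max addr_ge0 ?le_max ?lexx//=.
by rewrite -[leLHS](subrKA (y 0 i)) lerD// le_max lexx orbT.
Qed.

Lemma excess_le x y (e : R) : 0 <= e -> (forall i, x 0 i <= y 0 i + e) ->
  excess x y <= n%:R * e.
Proof.
move=> e0 xye; rewrite mulr_natl -[n in leRHS]card_ord -sumr_const.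
by apply: ler_sum => i _; rewrite ge_max e0 lerBlDl xye.
Qed.

(* McShane's extension for the asymmetric distance [excess]. *)
Definition mcshane D f x : R := sup [set f d - excess d x | d in D].

Section McShane.
Variables (D : set 'rV[R]_n) (f : 'rV[R]_n -> R).
Hypothesis f_lip : forall x y, D x -> D y -> f x - f y <= excess x y.

(** By [f_lip] and the triangle inequality through [x], [f e - f d <= excess e x + excess x d]. This
    makes the supremum finite and bounds it from above. *)
Lemma mcshane_ubound x d : D d ->
  ubound [set f e - excess e x | e in D] (f d + excess x d).
Proof.
move=> Dd _ [e De <-]; have := f_lip De Dd; have := excess_triangle x e d; lra.
Qed.

Lemma mcshane_ge x d : D d -> f d - excess d x <= mcshane D f x.
Proof.
move=> Dd; apply: ub_le_sup; last by exists d.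
by exists (f d + excess x d); exact: mcshane_ubound.
Qed.

Lemma mcshane_le x d : D d -> mcshane D f x <= f d + excess x d.
Proof.
move=> Dd; apply: ge_sup; last exact: mcshane_ubound.
by exists (f d - excess d x), d.
Qed.

Lemma mcshane_id d : D d -> mcshane D f d = f d.
Proof.
move=> Dd; apply/eqP; rewrite eq_le.
have := mcshane_ge d Dd; have := mcshane_le d Dd.
by rewrite excessxx subr0 addr0 => -> ->.
Qed.

Lemma mcshane_near x d (e : R) : D d -> 0 <= e ->
    (forall i, `|x 0 i - d 0 i| <= e) ->
  `|mcshane D f x - f d| <= n%:R * e.
Proof.
move=> Dd e0 xde.
have le1 : excess x d <= n%:R * e.
  by apply: excess_le => // i; have := xde i; rewrite ler_norml; lra.
have le2 : excess d x <= n%:R * e.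
  by apply: excess_le => // i; have := xde i; rewrite ler_norml; lra.
by rewrite ler_norml; have := mcshane_ge x Dd; have := mcshane_le x Dd; lra.
Qed.

End McShane.

Lemma box_volume_near f g x y a b (J : {set 'I_n}) (c : R) :
    (forall s : {set 'I_n}, s \subset J ->
      `|f (mix x y s) - g (mix a b s)| <= c) ->
  `|box_volume f x y J - box_volume g a b J| <= #|powerset J|%:R * c.
Proof.
move=> fg; rewrite /box_volume -sumrB mulr_natl -sumr_const.
apply: le_trans (ler_norm_sum _ _ _) _; apply: ler_sum => s.
rewrite powersetE => sJ.
by rewrite -mulrBr normrM normrX normrN1 expr1n mul1r fg.
Qed.

End Extension.

(** * One-sided approximation by mesh points, and passage to the limit in box volumes *)

Section DenseMesh.
Variables (R : realType) (n : nat) (delta : 'I_n -> set R).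
Hypothesis delta_dense : forall i, unit_itv R `<=` closure (delta i).
Hypothesis delta0 : forall i, delta i 0.
Hypothesis delta1 : forall i, delta i 1.

Lemma dense_near i (t r : R) : 0 < r -> 0 <= t <= 1 ->
  exists2 u, delta i u & t - r < u < t + r.
Proof.
move=> r0 t01.
have : closure (delta i) t by apply: delta_dense; rewrite /unit_itv/= in_itv.
move=> /(_ _ (nbhsx_ballx t r r0))[u [du]].
by rewrite /ball/= ltr_distlC => tu; exists u.
Qed.

(** Density only approximates from an unspecified side, so it is applied at [t + r] with radius [r],
    small enough to stay within [0,1] and within [e] of [t]. At [t = 1] there is no room, and the
    mesh point 1 itself serves. *)
Lemma dense_ge i (t e : R) : 0 <= t <= 1 -> 0 < e ->
  exists u, delta i u /\ t <= u <= t + e.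
Proof.
move=> t01 e0; have [t1|t1] := ltP t 1; last by exists 1; split => //; lra.
pose r := Num.min e (1 - t) / 2.
have r0 : 0 < r by rewrite divr_gt0// lt_min e0 subr_gt0.
have re : r + r <= e by rewrite -splitr ge_min lexx.
have rt : r + r <= 1 - t by rewrite -splitr ge_min lexx orbT.
have [|u du ur] := @dense_near i (t + r) r r0; first by lra.
by exists u; split => //; lra.
Qed.

Lemma dense_le i (t e : R) : 0 <= t <= 1 -> 0 < e ->
  exists u, delta i u /\ t - e <= u <= t.
Proof.
move=> t01 e0; have [t0|t0] := ltP 0 t; last by exists 0; split => //; lra.
pose r := Num.min e t / 2.
have r0 : 0 < r by rewrite divr_gt0// lt_min e0.
have re : r + r <= e by rewrite -splitr ge_min lexx.
have rt : r + r <= t by rewrite -splitr ge_min lexx orbT.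
have [|u du ur] := @dense_near i (t - r) r r0; first by lra.
by exists u; split => //; lra.
Qed.

Lemma mesh_ge (x : 'rV[R]_n) (e : R) : unit_cube R n x -> 0 < e ->
  exists2 d, mesh delta d & forall i, x 0 i <= d 0 i <= x 0 i + e.
Proof.
move=> Ix e0; have /choice[u hu] i := dense_ge i (Ix i) e0.
by exists (\row_i u i) => i; rewrite mxE; have [] := hu i.
Qed.

Lemma mesh_le (x : 'rV[R]_n) (e : R) : unit_cube R n x -> 0 < e ->
  exists2 d, mesh delta d & forall i, x 0 i - e <= d 0 i <= x 0 i.
Proof.
move=> Ix e0; have /choice[u hu] i := dense_le i (Ix i) e0.
by exists (\row_i u i) => i; rewrite mxE; have [] := hu i.
Qed.

Lemma mcshane_k_increasing k f : (0 < n)%N ->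
    (forall x y, mesh delta x -> mesh delta y -> f x - f y <= excess x y) ->
    k_increasing k (mesh delta) f ->
  k_increasing k (unit_cube R n) (mcshane (mesh delta) f).
Proof.
move=> n0 f_lip fk.
(* The cube is itself a mesh, with every coordinate set equal to [0,1]. *)
apply: (@box_volume_k_increasing _ _ (fun=> unit_itv R)).
move=> x y J Jk Ix Iy xyJ xyE.
apply/ler_addgt0Pr => e e0.
have N0 : 0 < (#|powerset J| * n)%:R :> R.
  by rewrite ltr0n muln_gt0 n0 card_powerset expn_gt0.
(* Each of the [#|powerset J|] vertices contributes an error of at most [n * c]. *)
pose c := e / (#|powerset J| * n)%:R.
have c0 : 0 < c by rewrite divr_gt0.
(* Moving [y] up and [x] down keeps the strict inequalities on [J]. Off [J] the lower corner [a]
   copies [b], so that the mesh box is degenerate in exactly the same directions. *)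
have [b Db yb] := mesh_ge Iy c0; have [a' Da' xa'] := mesh_le Ix c0.
pose a := mix b a' J.
have Da : mesh delta a by exact: mesh_mix.
have aE i : a 0 i = if i \in J then a' 0 i else b 0 i by rewrite mxE.
have : 0 <= box_volume f a b J.
  apply: (@k_increasing_volume_ge0 _ _ delta) => //; first by rewrite Jk.
    move=> i iJ; rewrite aE iJ.
    by have := xa' i; have := yb i; have := xyJ i iJ; lra.
  by move=> i iJ; rewrite aE (negbTE iJ).
have : `|box_volume (mcshane (mesh delta) f) x y J - box_volume f a b J| <= e.
  apply: le_trans (@box_volume_near _ _ _ _ _ _ _ _ _ (n%:R * c) _) _.
    move=> s sJ; apply: mcshane_near => //; [exact: mesh_mix|exact: ltW|move=> i].
    rewrite !(mxE, aE) ler_norml; case: ifP => _; first by have := yb i; lra.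
    case: ifPn => [_|/xyE->]; first by have := xa' i; lra.
    by have := yb i; lra.
  by rewrite mulrA -natrM mulrC divfK// gt_eqF.
by rewrite ler_norml; lra.
Qed.

End DenseMesh.

(** * Monotonicity of semicopulas on the cube, and the extension theorem *)

Lemma semicopula_le (R : realType) (n : nat) (A : 'rV[R]_n -> R) x y :
    semicopula A -> unit_cube R n x -> unit_cube R n y ->
    (forall i, x 0 i <= y 0 i) -> A x <= A y.
Proof.
move=> [A01 _ A1 _] Ix Iy xy.
(* [mesh_chain] asks for a bound on every one-coordinate change. Upward ones cost 0 for [- A]; for
   downward ones the crude bound 1 holds since [A] takes values in [0,1]. *)
pose w (s t : R) : R := if s <= t then 0 else 1.
have := @mesh_chain _ _ (fun=> unit_itv R) (fun z => - A z) w x y.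
rewrite big1 => [|i _]; last by rewrite /w xy.
suff Aw z i t : unit_cube R n z -> unit_itv R t ->
    - A (upd z i t) - - A z <= w (z 0 i) t.
  by move=> /(_ Aw Ix Iy); lra.
move=> Iz It; rewrite /w; case: ifP => [zt|_].
  by have := @increasing_upd _ _ (fun=> unit_itv R) _ _ _ _ A1 Iz It zt; lra.
have := A01 _ Iz; have := A01 _ (@mesh_upd _ _ (fun=> unit_itv R) _ i _ Iz It).
by rewrite /unit_itv/= !in_itv/=; lra.
Qed.

Theorem proposition6p2 (R : realType) (n k : nat)
    (hn : (0 < n)%N) (hk : (1 <= k <= n)%N) (hk1 : k <> 1%N)
    (A B : 'rV[R]_n -> R)
    (hA : semicopula A) (hB : semicopula B)
    (hAB : forall x, unit_cube R n x -> A x <= B x)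
    (D : set 'rV[R]_n) (hD : dense_countable_mesh D)
    (C : 'rV[R]_n -> R) (hC01 : set_fun D (unit_itv R) C)
    (hC : k_increasing k D C)
    (hACB : forall d, D d -> A d <= C d <= B d) :
  exists C' : 'rV[R]_n -> R,
    [/\ set_fun (unit_cube R n) (unit_itv R) C',
        forall d, D d -> C' d = C d,
        k_increasing k (unit_cube R n) C'
      & forall x, unit_cube R n x -> A x <= C' x <= B x].
Proof.
have [delta [hdelta DE]] := hD; subst D.
rewrite -/(mesh delta) in hC hC01 hACB *.
have dI i : delta i `<=` unit_itv R by have [] := hdelta i.
have d0 i : delta i 0 by have [_ _ _ []] := hdelta i.
have d1 i : delta i 1 by have [_ _ _ []] := hdelta i.
have ddense i : unit_itv R `<=` closure (delta i) by have [] := hdelta i.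
have d01 i t : delta i t -> 0 <= t <= 1 by move=> /dI; rewrite /unit_itv/= in_itv.
have dge0 i t : delta i t -> 0 <= t by move=> /d01/andP[].
have dle1 i t : delta i t -> t <= 1 by move=> /d01/andP[].
have DI : mesh delta `<=` unit_cube R n by move=> x Dx i; apply: dI (Dx i).
have k2 : (2 <= k <= n)%N.
  by case: k hk hk1 {hC} => [|[|k]].
have C0 x i : mesh delta x -> x 0 i = 0 -> C x = 0.
  move=> Dx xi; have [_ A0 _ _] := hA; have [_ B0 _ _] := hB.
  have := hACB _ Dx; rewrite A0 ?B0//; try by [exists i|exact: DI].
  by rewrite -eq_le => /eqP.
have C2 : k_increasing 2 (mesh delta) C by exact: (k_increasing_le k2).
have C1 : k_increasing 1 (mesh delta) C.
  by apply: (k_increasing_le (m := k)).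
have Cm i t : delta i t -> C (upd (const_mx 1) i t) = t.
  move=> Dt; have Du : mesh delta (upd (const_mx 1) i t).
    by apply: mesh_upd => // j; rewrite mxE.
  have := hACB _ Du.
  have -> : upd (const_mx 1) i t = \row_j (if j == i then t else 1).
    by apply/rowP => j; rewrite !mxE.
  have [_ _ _ ->] := hA; last exact: dI Dt.
  have [_ _ _ ->] := hB; last exact: dI Dt.
  by rewrite -eq_le => /eqP.
have C_lip x y : mesh delta x -> mesh delta y -> C x - C y <= excess x y.
  (* The chain runs from [y] to [x]: upward moves are controlled by [lipschitz_upd], downward ones
     by monotonicity. *)
  move=> Dx Dy; apply: (mesh_chain (w := fun s t => Num.max 0 (t - s))) Dy Dx.
  move=> z i t Dz Dt; rewrite le_max; have [zt|tz] := leP (z 0 i) t.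
    by rewrite (lipschitz_upd C2 d1 dle1 Cm Dz Dt zt) orbT.
  have := increasing_upd C1 (mesh_upd Dz Dt) (Dz i).
  by rewrite mxE eqxx upd_upd upd_id => /(_ (ltW tz)); rewrite -subr_le0 => ->.
pose C' := mcshane (mesh delta) C.
have C'AB x : unit_cube R n x -> A x <= C' x <= B x.
  move=> Ix; apply/andP; split; apply/ler_addgt0Pr => e e0.
    (* With [d] above [x]: [A x <= A d <= C d <= C' x + excess d x], and [n] coordinates of excess
       at most [e / n] add up to [e]. *)
    have e0' : 0 < e / n%:R by rewrite divr_gt0// ltr0n.
    have [d Dd xd] := mesh_ge ddense d1 Ix e0'.
    have : excess d x <= e.
      apply: le_trans (excess_le (ltW e0') _) _; first by move=> i; case/andP: (xd i).
      by rewrite mulrC divfK// pnatr_eq0 -lt0n.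
    have : A x <= A d by apply: semicopula_le (DI _ Dd) _ => // i; case/andP: (xd i).
    by have := mcshane_ge C_lip x Dd; have := hACB _ Dd; rewrite /C'; lra.
  (* With [d] below [x]: [C' x <= C d + excess x d <= B d + e <= B x + e]. *)
  have e0' : 0 < e / n%:R by rewrite divr_gt0// ltr0n.
  have [d Dd xd] := mesh_le ddense d0 Ix e0'.
  have : excess x d <= e.
    apply: le_trans (excess_le (ltW e0') _) _; first by move=> i; have := xd i; lra.
    by rewrite mulrC divfK// pnatr_eq0 -lt0n.
  have : B d <= B x by apply: semicopula_le (DI _ Dd) _ _ => // i; case/andP: (xd i).
  by have := mcshane_le C_lip x Dd; have := hACB _ Dd; rewrite /C'; lra.
exists C'; split => //.
- move=> x Ix; have [A01 _ _ _] := hA; have [B01 _ _ _] := hB.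
  have := A01 _ Ix; have := B01 _ Ix; have := C'AB _ Ix.
  by rewrite /unit_itv/= !in_itv/=; lra.
- by move=> d; exact: mcshane_id.
- exact: mcshane_k_increasing.
Qed.
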